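(* Let $\mathfrak{g}$ be a Lie algebra, $(M,\bullet)$ a $\mathfrak{g}$-module, $T: M \to \mathfrak{g}$ an $\mathcal{O}$-operator on $M$ over $\mathfrak{g}$, and $B : \mathfrak{g} \to M$ a $1$-cocycle in the Chevalley-Eilenberg complex of $\mathfrak{g}$ with coefficients in $M$. If the linear map $\mathrm{id}_M + B \circ T : M \to M$ is invertible, then the subspace $\tau_B(\mathrm{Gr}(T)) = \{ (T(m), m + B(T(m))) \mid m \in M\} \subset \mathfrak{g}\oplus M$ is the graph $\{(T_B(m), m) \mid m\in M\}$ of the linear map $T_B := T \circ (\mathrm{id}_M + B \circ T)^{-1} : M \to \mathfrak{g}$, and $T_B$ is an $\mathcal{O}$-operator on $M$ over $\mathfrak{g}$.
   Context: All vector spaces are over a field of characteristic $0$. A $\mathfrak{g}$-module $(M,\bullet)$ is a vector space with a bilinear map $\bullet:\mathfrak{g}\times M\to M$ such that $[x,y]\bullet m = x\bullet(y\bullet m) - y\bullet(x\bullet m)$. An $\mathcal{O}$-operator on $M$ over $\mathfrak{g}$ is a linear map $T: M\to\mathfrak{g}$ with $[T(m),T(n)] = T(T(m)\bullet n - T(n)\bullet m)$ for all $m,n\in M$. A linear map $B:\mathfrak{g}\to M$ is a $1$-cocycle if $B([x,y]) = x\bullet B(y) - y\bullet B(x)$ for all $x,y\in\mathfrak{g}$. For a subspace $L\subset \mathfrak{g}\oplus M$, $\tau_B(L) := \{(x, m+B(x)) \mid (x,m)\in L\}$; $\mathrm{Gr}(T) := \{(T(m),m)\mid m\in M\}$. 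*)

(* Defs.v *)
From HB Require Import structures.
From mathcomp Require Import all_boot all_order all_algebra.
From mathcomp Require Import boolp classical_sets functions.

Set Implicit Arguments.
Unset Strict Implicit.
Unset Printing Implicit Defensive.

Import GRing.Theory.
Local Open Scope ring_scope.
Local Open Scope classical_set_scope.

(* lmodType carries no finiteness assumption, so dimensions are arbitrary. *)
HB.mixin Record Lmodule_isLieAlgebra (F : fieldType) g of GRing.Lmodule F g := {
  lie_bracket : g -> g -> g;
  lie_bracket_bilinear : bilinear_for *:%R *:%R lie_bracket;
  lie_bracketxx : forall x, lie_bracket x x = 0;
  lie_jacobi : forall x y z,
    lie_bracket x (lie_bracket y z) + lie_bracket y (lie_bracket z x)
      + lie_bracket z (lie_bracket x y) = 0
}.

#[short(type="lieAlgType")]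
HB.structure Definition LieAlgebra (F : fieldType) :=
  { g of Lmodule_isLieAlgebra F g & GRing.Lmodule F g }.

Notation "[ 'lie' x , y ]" := (lie_bracket x y)
  (at level 0, x at level 99, y at level 99, format "[ 'lie'  x ,  y ]")
  : ring_scope.

Section OOperators.
Variables (F : fieldType) (g : lieAlgType F) (M : lmodType F).

Definition is_lie_action (act : {bilinear g -> M -> M}) : Prop :=
  forall x y m, act [lie x, y] m = act x (act y m) - act y (act x m).

Definition is_O_operator (act : {bilinear g -> M -> M}) (T : M -> g) : Prop :=
  linear T /\
  forall m n, [lie T m, T n] = T (act (T m) n - act (T n) m).

Definition is_1cocycle (act : {bilinear g -> M -> M}) (B : g -> M) : Prop :=
  linear B /\
  forall x y, B [lie x, y] = act x (B y) - act y (B x).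

(* Subsets of the direct sum of g and M are sets of pairs in g * M. *)
Definition tau (B : g -> M) (L : set (g * M)) : set (g * M) :=
  [set (p.1, p.2 + B p.1) | p in L].

Definition Gr (T : M -> g) : set (g * M) := [set (T m, m) | m in [set: M]].

End OOperators.

(* [bijective] only asserts that an inverse exists; this names it. *)
Definition inverse_map (U V : Type) (f : U -> V) (f_bij : bijective f) : V -> U :=
  ((bijection_of_bijective f_bij)^-1)%FUN.

Lemma inverse_mapK (U V : Type) (f : U -> V) (f_bij : bijective f) :
  cancel f (inverse_map f_bij).
Proof.
by move=> u; have /(_ u (in_setT u)) := 'funK_(bijection_of_bijective f_bij).
Qed.

Lemma inverse_mapVK (U V : Type) (f : U -> V) (f_bij : bijective f) :
  cancel (inverse_map f_bij) f.
Proof.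
by move=> v; have /(_ v (in_setT v)) := 'invK_(bijection_of_bijective f_bij).
Qed.

(* Main.v *)
Require Import Defs.
From HB Require Import structures.
From mathcomp Require Import all_boot all_order all_algebra.
From mathcomp Require Import boolp classical_sets functions.

Set Implicit Arguments.
Unset Strict Implicit.
Unset Printing Implicit Defensive.

Import GRing.Theory.
Local Open Scope ring_scope.
Local Open Scope classical_set_scope.

(** Write [f := id + B \o T]. Since [Gr T_B] is parametrised by [f p |-> (T p, f p)], it
    is the shear of [Gr T]. For [m = f p] and [n = f q], the cocycle condition gives
    [act (T p) n - act (T q) m = w + B [T p, T q]] with [w := act (T p) q - act (T q) p];
    as [[T p, T q] = T w] this is [f w], and [T_B (f w) = T w = [T p, T q]]. *)

(** Both sides have the same image under [f], which is injective. *)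
Lemma inverse_map_linear (F : fieldType) (U V : lmodType F) (f : U -> V)
    (f_bij : bijective f) :
  linear f -> linear (inverse_map f_bij).
Proof.
move=> f_lin a u v; apply: (can_inj (inverse_mapK f_bij)).
by rewrite f_lin !inverse_mapVK.
Qed.

Theorem mainTheorem1 (F : fieldType) (F_char0 : [pchar F] =i pred0)
    (g : lieAlgType F) (M : lmodType F)
    (act : {bilinear g -> M -> M}) (act_lie : is_lie_action act)
    (T : M -> g) (T_O : is_O_operator act T)
    (B : g -> M) (B_cocycle : is_1cocycle act B)
    (idBT_bij : bijective (fun m : M => m + B (T m))) :
  let T_B : M -> g := T \o inverse_map idBT_bij in
  [/\ tau B (Gr T) = [set (T m, m + B (T m)) | m in [set: M]],
      tau B (Gr T) = Gr T_B
    & is_O_operator act T_B].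
Proof.
move=> T_B; case: T_O => T_lin T_bracket; case: B_cocycle => B_lin B_bracket.
have tauE : tau B (Gr T) = [set (T m, m + B (T m)) | m in [set: M]].
  by rewrite /tau /Gr image_comp.
have f_lin : linear (fun m : M => m + B (T m)).
  by move=> a m n; rewrite T_lin B_lin scalerDr addrACA.
pose finv := inverse_map idBT_bij.
have finvK m : finv (m + B (T m)) = m := inverse_mapK idBT_bij m.
have finvVK m : finv m + B (T (finv m)) = m := inverse_mapVK idBT_bij m.
have T_BE m : T_B (m + B (T m)) = T m by rewrite /T_B /= -/finv finvK.
split=> //.
  rewrite tauE; apply/seteqP; split=> _ [m _ <-].
    by exists (m + B (T m)); rewrite ?T_BE.
  (* [T_B m] is [T (finv m)] by definition, so only the second component needs the inverse law. *)
  by exists (finv m); rewrite ?finvVK.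
split=> [a m n | m n].
  by rewrite /T_B /= (inverse_map_linear idBT_bij f_lin) T_lin.
(* With both arguments written as values of [f], [T_BE] evaluates every [T_B] except the outer
   one. *)
rewrite -(finvVK m) -(finvVK n).
move: (finv m) (finv n) => p q; rewrite !T_BE.
set w := act (T p) q - act (T q) p.
have -> : act (T p) (q + B (T q)) - act (T q) (p + B (T p)) = w + B (T w).
  (* Turning [T w] back into a bracket makes the cocycle identity applicable to [B (T w)]. *)
  by rewrite -T_bracket B_bracket !linearDr /= opprD addrACA.
by rewrite T_BE.
Qed.
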